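(* Let $\mathbb{O}$ be an octonion algebra over a field $k$ of characteristic not two or three, let $\mathfrak{h}=C^2(\mathrm{Im}(\mathbb{O}),-q)$ with $B_{\mathfrak{h}}(x,y)=-\frac{3}{8}\mathrm{Tr}(\rho(x)\rho(y))$, and let $\mathfrak{g}\subset\mathfrak{h}$, $\mu_{\mathrm{Im}}$ and $c_u$ be as in the context. The moment map $\mu_{\mathbb{O}}: \Lambda^2(\mathbb{O})\rightarrow \mathfrak{h}$ of the spinor representation $\rho:\mathfrak{h}\to\mathfrak{so}(\mathbb{O},B)$ satisfies \begin{align*} \mu_{\mathbb{O}}(u,v)&=\frac{8}{9}\mu_{\mathrm{Im}}(u,v)+\frac{1}{18}c_{u\times v} && \forall u,v\in \mathrm{Im}(\mathbb{O}),\\ \mu_{\mathbb{O}}(u,1)&=\frac{1}{6}c_u && \forall u\in \mathrm{Im}(\mathbb{O}). \end{align*}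
   Context: $\mathbb{O}$ is an octonion (Cayley) algebra over $k$, i.e. an $8$-dimensional unital composition algebra, with norm $q$ and conjugation $u\mapsto\bar u$, $q(u)=u\bar u$; $\mathrm{Im}(\mathbb{O})=\{u\in\mathbb{O}: \bar u=-u\}$; $B$ is the symmetric bilinear form with $B(u,u)=q(u)$. The cross-product is $u\times v=\frac12(\bar v u-\bar u v)$ (so $u\times v=\frac12(uv-vu)$ on $\mathrm{Im}(\mathbb{O})$), and $\phi$ is the alternating trilinear form on $\mathrm{Im}(\mathbb{O})$ given by $\phi(u,v,w)=B(u,v\times w)$. The isomorphism $\eta:\Lambda^i(\mathrm{Im}(\mathbb{O}))\to\Lambda^i(\mathrm{Im}(\mathbb{O}))^*$ is given by $\eta(v_1\wedge\dots\wedge v_i)(w_1\wedge\dots\wedge w_i)=\det(B(v_a,w_b))$. Left multiplication $\rho(u)(x)=ux$ ($u\in\mathrm{Im}(\mathbb{O})$, $x\in\mathbb{O}$) satisfies $\rho(u)^2=-q(u)\mathrm{Id}$, hence extends to an algebra morphism $\rho:C(\mathrm{Im}(\mathbb{O}),-q)\to\mathrm{End}(\mathbb{O})$ from the Clifford algebra (in which $u^2=-q(u)$). The quantisation map $\mathcal{Q}:\Lambda(\mathrm{Im}(\mathbb{O}))\to C(\mathrm{Im}(\mathbb{O}),-q)$ is the linear isomorphism sending $v_1\wedge\dots\wedge v_n$ to $v_1\cdots v_n$ for pairwise orthogonal $v_1,\dots,v_n$; $C^i(\mathrm{Im}(\mathbb{O}),-q)=\mathcal{Q}(\Lambda^i(\mathrm{Im}(\mathbb{O})))$.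 $\mathfrak{h}=C^2(\mathrm{Im}(\mathbb{O}),-q)$ is a Lie algebra under the commutator (of type $\mathfrak{so}(7)$), acting on $\mathbb{O}$ by $\rho$ (the spinor representation). Set $\Omega=\mathcal{Q}(\eta^{-1}(\phi))$ and $c_u=u\Omega+\Omega u\in\mathfrak{h}$ for $u\in\mathrm{Im}(\mathbb{O})$. $\mathfrak{g}=\{x\in\mathfrak{h}: \rho(x)(1)=0\}$ is a Lie algebra of type $G_2$ acting on $\mathrm{Im}(\mathbb{O})$ by $\rho$, with $B_{\mathfrak{g}}(x,y)=-\frac13\mathrm{Tr}(\rho(x)\rho(y))$. The moment maps are the alternating maps determined by $B_{\mathfrak{g}}(x,\mu_{\mathrm{Im}}(u,v))=B(\rho(x)(u),v)$ for all $x\in\mathfrak{g}$, $u,v\in\mathrm{Im}(\mathbb{O})$, and $B_{\mathfrak{h}}(x,\mu_{\mathbb{O}}(u,v))=B(\rho(x)(u),v)$ for all $x\in\mathfrak{h}$, $u,v\in\mathbb{O}$. *)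

(* Defs.v *)
From HB Require Import structures.
From mathcomp Require Import all_boot all_order all_algebra all_field.
From mathcomp Require Import ring.

Set Implicit Arguments.
Unset Strict Implicit.
Unset Printing Implicit Defensive.

Import GRing.Theory.
Local Open Scope ring_scope.

(** Octonion algebras: 8-dimensional unital, not necessarily associative,
    composition algebras.  The product is a separate operation [omul], since
    MathComp rings are associative. *)

HB.mixin Record Vector_isOctonion (k : fieldType) O of Vector k O := {
  omul : O -> O -> O;
  oone : O;
  onorm : O -> k;
  omul_linearl : forall y, linear (omul^~ y);
  omul_linearr : forall x, linear (omul x);
  omul1o : left_id oone omul;
  omulo1 : right_id oone omul;
  onormZ : forall (a : k) u, onorm (a *: u) = a ^+ 2 * onorm u;
  onorm_polar_scalar :
    forall v, scalar (fun u => onorm (u + v) - onorm u - onorm v);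
  onorm_nondeg :
    forall u, (forall v, onorm (u + v) - onorm u - onorm v = 0) -> u = 0;
  onormM : {morph onorm : x y / omul x y >-> x * y};
  odim : \dim {: O} = 8%N
}.

#[short(type="octonionType")]
HB.structure Definition Octonion (k : fieldType) :=
  { O of Vector k O & Vector_isOctonion k O }.

Section OctonionTheory.

Context {k : fieldType} {O : octonionType k}.
Implicit Types u v w x : O.

Definition opolar u v : k := onorm (u + v) - onorm u - onorm v.

(* In characteristic not two, [bform u u = onorm u]. *)
Definition bform u v : k := 2%:R^-1 * opolar u v.

(* [opolar u 1] is the trace of [u], so [omul u (oconj u) = onorm u *: 1]. *)
Definition oconj u : O := opolar u oone *: oone - u.

Lemma opolarC u v : opolar u v = opolar v u.
Proof. by rewrite /opolar [u + v]addrC addrAC. Qed.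

Lemma opolarPl a u w v : opolar (a *: u + w) v = a * opolar u v + opolar w v.
Proof. exact: onorm_polar_scalar. Qed.

Definition oconjD u : O := oconj u + u.

Fact oconjD_is_linear : linear oconjD.
Proof.
by move=> a u v; rewrite /oconjD /oconj !subrK opolarPl scalerDl scalerA.
Qed.

HB.instance Definition _ :=
  GRing.isLinear.Build k O O *:%R oconjD oconjD_is_linear.

(* [u \in oIm] iff [oconj u = - u], see [mem_oIm]. *)
Definition oIm : {vspace O} := lker (linfun oconjD).

Lemma mem_oIm u : (u \in oIm) = (oconj u == - u).
Proof. by rewrite memv_ker lfunE /= addr_eq0. Qed.

Definition cross u v : O :=
  2%:R^-1 *: (omul (oconj v) u - omul (oconj u) v).

Lemma opolarDl u v w : opolar (u + v) w = opolar u w + opolar v w.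
Proof. by rewrite -[u in LHS]scale1r opolarPl mul1r. Qed.

Lemma opolarDr u v w : opolar u (v + w) = opolar u v + opolar u w.
Proof. by rewrite opolarC opolarDl !(opolarC u). Qed.

Lemma opolarZl a u v : opolar (a *: u) v = a * opolar u v.
Proof.
have p0 : opolar 0 v = 0 by apply: (addrI (opolar 0 v)); rewrite -opolarDl !addr0.
by rewrite -[a *: u]addr0 opolarPl p0 addr0.
Qed.

Lemma omulPl (a : k) u v x : omul (a *: u + v) x = a *: omul u x + omul v x.
Proof. exact: omul_linearl. Qed.

Lemma omulDl u v x : omul (u + v) x = omul u x + omul v x.
Proof. by rewrite -[u in LHS]scale1r omulPl scale1r. Qed.

Lemma omulDr x u v : omul x (u + v) = omul x u + omul x v.
Proof. by rewrite -[u in LHS]scale1r omul_linearr scale1r. Qed.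

Lemma opolarM w u v : opolar (omul w u) (omul w v) = onorm w * opolar u v.
Proof. by rewrite {1}/opolar -omulDr !onormM /opolar; ring. Qed.

Lemma opolar_mulDl w u v :
  opolar (omul w u) v + opolar u (omul w v) = opolar w oone * opolar u v.
Proof.
have := opolarM (w + oone) u v; rewrite !omulDl !omul1o.
rewrite opolarDl !opolarDr opolarM.
have n1 : onorm (oone : O) * opolar u v = opolar u v by rewrite -opolarM !omul1o.
have -> : onorm (w + oone) = opolar w oone + onorm w + onorm (oone : O).
  by rewrite /opolar; ring.
rewrite !mulrDl n1 => E.
apply: (addrI (onorm w * opolar u v + opolar u v)).
by rewrite [in RHS]addrC [RHS]addrA -E; ring.
Qed.

Fact opolar_conjl u v : opolar (omul (oconj u) v) oone = opolar u v.
Proof.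
have E := opolar_mulDl u v oone; rewrite omulo1 in E.
rewrite /oconj -scaleN1r omulDl.
have mulZl (a : k) x : omul (a *: x) v = a *: omul x v.
  have m0 : omul 0 v = 0 by apply: (addrI (omul 0 v)); rewrite -omulDl !addr0.
  by rewrite -[a *: x]addr0 omulPl m0 addr0.
rewrite !mulZl omul1o opolarDl !opolarZl -E (opolarC v u); ring.
Qed.

Lemma cross_in_oIm u v : cross u v \in oIm.
Proof.
rewrite mem_oIm /oconj /cross opolarZl -scaleN1r opolarDl opolarZl.
by rewrite !opolar_conjl (opolarC v) mulN1r subrr mulr0 scale0r sub0r.
Qed.

End OctonionTheory.

Notation ImO O := (subvs_of (@oIm _ O)).

Definition crossIm {k : fieldType} {O : octonionType k} (u v : ImO O) : ImO O :=
  Subvs (cross_in_oIm (vsval u) (vsval v)).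

Definition phi {k : fieldType} {O : octonionType k} (u v w : ImO O) : k :=
  bform (vsval u) (vsval (crossIm v w)).

(** Clifford algebras, given by their universal property among all unital
    associative algebras. *)

Record clifford_algebra (k : fieldType) (V : vectType k) (Q : V -> k) := {
  clifford_sort :> falgType k;
  clifford_in : 'Hom(V, clifford_sort);
  clifford_sqr : forall v, clifford_in v * clifford_in v = (Q v)%:A;
  clifford_lift : forall (A : algType k) (f : {linear V -> A}),
    (forall v, f v * f v = (Q v)%:A) ->
    exists g : {lrmorphism clifford_sort -> A},
      forall v, g (clifford_in v) = f v;
  clifford_ext : forall (A : algType k) (g g' : {lrmorphism clifford_sort -> A}),
    (forall v, g (clifford_in v) = g' (clifford_in v)) -> g =1 g'
}.

Definition exterior_algebra (k : fieldType) (V : vectType k) :=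
  clifford_algebra (fun _ : V => 0 : k).

(* The [i]-th exterior power: the span of all [i]-fold wedge products. *)
Definition ext_power (k : fieldType) (V : vectType k)
    (L : exterior_algebra V) (i : nat) : {vspace L} :=
  (limg (clifford_in L) ^+ i)%VS.

Definition wedge (k : fieldType) (V : vectType k) (L : exterior_algebra V)
    (n : nat) (v : 'I_n -> V) : L :=
  \prod_(i < n) clifford_in L (v i).

Notation ClO O := (@clifford_algebra _ (ImO O) (fun u => - onorm (vsval u))).

Section Spinor.

Context {k : fieldType} {O : octonionType k}.
Context {L : exterior_algebra (ImO O)} {C : ClO O}.

Definition is_quantisation (Q : 'Hom(L, C)) : Prop :=
  bijective Q /\
  forall (n : nat) (v : 'I_n -> ImO O),
    (forall a b, a != b -> bform (vsval (v a)) (vsval (v b)) = 0) ->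
    Q (wedge L v) = \prod_(i < n) clifford_in C (v i).

(* The maps [eta] on all exterior powers, as one bilinear pairing on the
   exterior algebra; its value on different degrees is irrelevant. *)
Definition is_eta (eta : 'Hom(L, 'Hom(L, k^o))) : Prop :=
  forall (n : nat) (v w : 'I_n -> ImO O),
    eta (wedge L v) (wedge L w) =
      \det (\matrix_(a < n, b < n) bform (vsval (v a)) (vsval (w b))).

Definition is_eta_inv_phi (eta : 'Hom(L, 'Hom(L, k^o))) (omega : L) : Prop :=
  omega \in ext_power L 3 /\
  forall w : 'I_3 -> ImO O,
    eta omega (wedge L w) = phi (w 0) (w 1) (w 2%:R).

Definition is_spinor (rho : 'Hom(C, 'End(O))) : Prop :=
  [/\ rho 1 = \1%VF,
      forall x y, rho (x * y) = (rho x \o rho y)%VF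
    & forall (u : ImO O) (x : O), rho (clifford_in C u) x = omul (vsval u) x].

Definition cliff_power (Q : 'Hom(L, C)) (i : nat) : {vspace C} :=
  (Q @: ext_power L i)%VS.

Definition h_alg (Q : 'Hom(L, C)) : {vspace C} := cliff_power Q 2.

Definition g_alg (Q : 'Hom(L, C)) (rho : 'Hom(C, 'End(O))) : {pred C} :=
  [pred x | (x \in h_alg Q) && (rho x oone == 0)].

Definition c_elt (Q : 'Hom(L, C)) (omega : L) (u : ImO O) : C :=
  clifford_in C u * Q omega + Q omega * clifford_in C u.

(* The trace of the restriction of [f] to [U], when [f] preserves [U]. *)
Definition trace_on (U : {vspace O}) (f : 'End(O)) : k :=
  \sum_(i < \dim U) coord (vbasis U) i (f (vbasis U)`_i).

Definition B_h (rho : 'Hom(C, 'End(O))) (x y : C) : k :=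
  - (3%:R / 8%:R) * trace_on fullv (rho x \o rho y)%VF.

Definition B_g (rho : 'Hom(C, 'End(O))) (x y : C) : k :=
  - (1 / 3%:R) * trace_on oIm (rho x \o rho y)%VF.

(* An alternating map [Lambda^2 V -> s] is an alternating bilinear map on [V]
   with values in [s]; [inO] embeds [V] in [O]. *)
Definition is_moment_map (rho : 'Hom(C, 'End(O))) (s : {pred C})
    (Bs : C -> C -> k) (V : vectType k) (inO : V -> O)
    (mu : V -> V -> C) : Prop :=
  [/\ forall v, linear (mu^~ v),
      forall u, linear (mu u),
      forall u, mu u u = 0,
      forall u v, mu u v \in s
    & forall x u v, x \in s -> Bs x (mu u v) = bform (rho x (inO u)) (inO v)].

End Spinor.

(* Main.v *)
Require Import Defs.
From HB Require Import structures.
From mathcomp Require Import all_boot all_order all_algebra all_field.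
From mathcomp Require Import ring.

Set Implicit Arguments.
Unset Strict Implicit.
Unset Printing Implicit Defensive.

Import GRing.Theory.
Local Open Scope ring_scope.

(** Both identities compare elements of [h], the space of bivectors of the
    Clifford algebra, so they follow by pairing with all bivectors under the
    trace form [tr (rho x \o rho y)], once this form is known to be
    nondegenerate on [h].

    The form is computable without choosing matrices: a trace is central, and
    the Clifford relation then determines it on products of two and four
    vectors.  On bivectors it is [-8] times the Gram determinant
    ([tau_bivectors]).  Expanding in an orthogonal frame recovers a bivector
    from its commutators with vectors, and those from its trace pairings
    ([bivector_commutator], [bivector_reconstruct]); nondegeneracy follows.

    On the frame one also reads off the quantisation map in degrees two and
    three ([quantisation2], [quantisation3]).  Up to the factor [-2],
    anticommuting a quantised trivector with a vector [u] is contraction by [u],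
    so [c_u] is a bivector, and it pairs with the bivector of [x] and [y] to
    [16 * phi u x y] ([c_bivector_spec]).  Since the bivector of [x] and
    [y] sends [1] to their cross product, the pairing of [c_u] with any [z] in
    [h] is [16 * B(u, z 1)] ([c_bivector_pairing]).  The second identity of the
    theorem compares this with the moment map condition, as [rho z] is skew.

    For the first identity one needs the action of [c_u] itself.  Its
    commutators are [-4] times the cross product with [u]; reconstructing [c_u]
    from them and using [e x (e x u) = B(e,u) e - B(e,e) u] gives [c_u 1 = -6 u]
    ([rho_c_bivector1]), whence [c_u v = 2 u x v + 6 B(u,v)].  Therefore
    [h] is the sum of [g] and of the [c_u], and the two summands are orthogonal.
    The product of two elements of [g] maps the octonions into their imaginary
    part, so its traces there and on all octonions agree, and the two
    invariant forms are proportional on [g]: the constant is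
    [(3/8) / (1/3) = 9/8], whence the factor [8/9].  The factor [1/18] comes from
    pairing with [c_w]: the trace of [rho (c_w) rho (c_z)] is [-96 * B(w, z)],
    while [B(c_w u, v) = 2 * B(w, u x v)]. *)

(** * Linear algebra *)
Section Functionals.

Context {k : fieldType} {V : vectType k}.

(** Linear functionals separate vectors.  Testing an identity of vectors on
    an arbitrary functional turns it into an identity of scalars, which [ring]
    can prove with the values of the functional as atoms. *)
Lemma functional_ext (x y : V) : (forall f : {scalar V}, f x = f y) -> x = y.
Proof.
move=> E; rewrite (coord_vbasis (memvf x)) (coord_vbasis (memvf y)).
by apply: eq_bigr => i _; rewrite (E (coord (vbasis fullv) i)).
Qed.

End Functionals.

Ltac linear_ring :=
  apply: functional_ext => ?;
  rewrite ?(linearD, linearN, linearB, linearZ, linearMn) /=; ring.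

(** * Orthogonal frames of a symmetric bilinear form *)
Section SymmetricForm.

Context {k : fieldType} {V : vectType k} (b : V -> V -> k).
Hypothesis char2 : 2%:R != 0 :> k.
Hypothesis bC : forall u v, b u v = b v u.
Hypothesis b_linear : forall v, scalar (b ^~ v).

Lemma sformDl u v w : b (u + v) w = b u w + b v w.
Proof. by rewrite -[u in LHS]scale1r b_linear mul1r. Qed.

Lemma sform0l v : b 0 v = 0.
Proof. by apply: (addrI (b 0 v)); rewrite -sformDl !addr0. Qed.

Lemma sformZl a u v : b (a *: u) v = a * b u v.
Proof. by rewrite -[a *: u]addr0 b_linear sform0l addr0. Qed.

Lemma sformNl u v : b (- u) v = - b u v.
Proof. by rewrite -scaleN1r sformZl mulN1r. Qed.

Lemma sformBl u v w : b (u - v) w = b u w - b v w.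
Proof. by rewrite sformDl sformNl. Qed.

Lemma sformDr u v w : b u (v + w) = b u v + b u w.
Proof. by rewrite bC sformDl !(bC u). Qed.

Lemma sformZr a u v : b u (a *: v) = a * b u v.
Proof. by rewrite bC sformZl bC. Qed.

Lemma sformNr u v : b u (- v) = - b u v.
Proof. by rewrite bC sformNl bC. Qed.

Lemma sform_suml I (r : seq I) (P : pred I) (F : I -> V) v :
  b (\sum_(i <- r | P i) F i) v = \sum_(i <- r | P i) b (F i) v.
Proof. exact: (big_morph (b ^~ v) (fun x y => sformDl x y v) (sform0l v)). Qed.

Lemma sform_hom v : {f : 'Hom(V, k^o) | forall x, f x = b x v}.
Proof.
have @f : {linear V -> k^o} :=
  HB.pack (b ^~ v : V -> k^o) (GRing.isLinear.Build k V k^o *:%R (b ^~ v) (b_linear v)).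
by exists (linfun f) => x; rewrite lfunE.
Qed.

Lemma size_basis_seq (U : {vspace V}) s : basis_of U s -> size s = \dim U.
Proof. by rewrite /basis_of => /andP[/eqP<- /eqP]. Qed.

(** Polarisation: if the basis vectors [x] and [y] are isotropic and not
    orthogonal, then [x + y] has norm [2 * b x y], which is not zero. *)
Lemma anisotropic_vector (U : {vspace V}) :
  (exists2 v, v \in U & b v v != 0) \/ {in U &, forall u v, b u v = 0}.
Proof.
have [/hasP[x xU /hasP[y yU bxy]]|none] :=
  boolP (has (fun x => has (fun y => b x y != 0) (vbasis U)) (vbasis U)).
  left; have [x2|x2] := eqVneq (b x x) 0; last by exists x => //; apply: vbasis_mem.
  have [y2|y2] := eqVneq (b y y) 0; last by exists y => //; apply: vbasis_mem.
  exists (x + y); first by rewrite rpredD // vbasis_mem.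
  rewrite sformDl !sformDr x2 y2 (bC y x) addr0 add0r.
  have -> : b x y + b x y = 2%:R * b x y by ring.
  by rewrite mulf_neq0.
right=> u v uU vU; rewrite (coord_vbasis uU) sform_suml big1 // => i _.
rewrite sformZl bC (coord_vbasis vU) sform_suml big1 ?mulr0 // => j _.
rewrite sformZl; case: (eqVneq (b (vbasis U)`_j (vbasis U)`_i) 0) => [->|bji].
  by rewrite mulr0.
case/negP: none; apply/hasP; exists (vbasis U)`_j.
  by rewrite mem_nth ?size_tuple.
apply/hasP; exists (vbasis U)`_i; rewrite ?mem_nth ?size_tuple //.
Qed.

(** Diagonalisation by splitting off an anisotropic vector [v]: the orthogonal
    complement of [v] in [U] has smaller dimension, and the projection along
    [v] shows that the two together span [U]. *)
Lemma orthogonal_basis (U : {vspace V}) :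
  exists2 s : seq V, basis_of U s & pairwise (fun x y => b x y == 0) s.
Proof.
have [n] := ubnP (\dim U); elim: n => // n IHn in U *; rewrite ltnS => dimU.
case: (anisotropic_vector U) => [[v vU v2]|U0]; last first.
  exists (vbasis U); first exact: vbasisP.
  apply/(pairwiseP 0) => i j; rewrite !inE => ilt jlt _; apply/eqP.
  by apply: U0; apply: vbasis_mem; apply: mem_nth.
have [f fE] := sform_hom v.
pose W := (U :&: lker f)%VS.
have memW x : (x \in W) = (x \in U) && (b x v == 0).
  by rewrite memv_cap memv_ker fE.
have vW : v \notin W by rewrite memW vU.
have WU : (W <= U)%VS by apply: capvSl.
have ltWU : (\dim W < \dim U)%N.
  rewrite ltnNge; apply: contra vW => leUW.
  by have /eqP-> : W == U by rewrite eqEdim WU.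
have [s sW s_orth] := IHn W (leq_trans ltWU dimU).
exists (v :: s); last first.
  rewrite pairwise_cons s_orth andbT; apply/allP => x xs.
  by have := basis_mem sW xs; rewrite memW bC => /andP[].
rewrite basisEdim; apply/andP; split; last first.
  by rewrite /= (size_basis_seq sW).
apply/subvP => x xU; rewrite span_cons.
rewrite -[x](subrK (b x v / b v v *: v)) addrC.
apply: memv_add; first by apply: memvZ; apply: memv_line.
rewrite (span_basis sW) memW rpredB ?memvZ //=.
by rewrite sformBl sformZl divfK // subrr.
Qed.

(** The last clause is the expansion of a vector in an orthogonal basis; it is
    the only form in which spanning and independence are used below. *)
Definition orthogonal_frame n (e : 'I_n -> V) :=
  [/\ forall i j, i != j -> b (e i) (e j) = 0,
      forall i, b (e i) (e i) != 0
    & forall x, x = \sum_i (b x (e i) / b (e i) (e i)) *: e i].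

Lemma orthogonal_frame_exists :
  (forall u, (forall v, b u v = 0) -> u = 0) ->
  exists e : 'I_(\dim {: V}) -> V, orthogonal_frame e.
Proof.
move=> nondeg; have [s sV /(pairwiseP 0) s_orth] := orthogonal_basis fullv.
have sz : size s == \dim {: V} by rewrite (size_basis_seq sV).
pose t : (\dim {: V}).-tuple V := Tuple sz.
have tV : basis_of fullv t by [].
pose e (i : 'I_(\dim {: V})) := t`_i.
have e_orth i j : i != j -> b (e i) (e j) = 0.
  have inD (l : 'I_(\dim {: V})) : (l : nat) \in gtn (size s).
    by rewrite inE (eqP sz).
  rewrite neq_ltn => /orP[] lt; last rewrite bC; apply/eqP; exact: s_orth.
have b_e x i : b x (e i) = coord t i x * b (e i) (e i).
  rewrite {1}(coord_basis tV (memvf x)) sform_suml (bigD1 i) //= sformZl.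
  by rewrite big1 ?addr0 // => j ji; rewrite sformZl e_orth ?mulr0.
have e2 i : b (e i) (e i) != 0.
  apply/eqP => ei0; have /nondeg e0 : forall v, b (e i) v = 0.
    by move=> v; rewrite bC b_e ei0 mulr0.
  have := basis_not0 sV (mem_nth 0 (_ : (i < size s)%N)).
  by rewrite -[s]/(val t) -/(e i) e0 eqxx (eqP sz) => /(_ (ltn_ord i)).
exists e; split=> // x; rewrite [LHS](coord_basis tV (memvf x)).
by apply: eq_bigr => i _; rewrite b_e mulfK.
Qed.

End SymmetricForm.

(** * Traces of endomorphisms *)
Section Trace.

Context {k : fieldType} {O : octonionType k}.
Implicit Types (f g : 'End(O)) (U : {vspace O}).

Lemma trace_on_is_scalar U : scalar (@trace_on k O U).
Proof.
move=> a f g; rewrite /trace_on mulr_sumr -big_split; apply: eq_bigr => i _.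
by rewrite add_lfunE scale_lfunE linearP.
Qed.

Lemma trace_on_mulC f g :
  trace_on fullv (f \o g)%VF = trace_on fullv (g \o f)%VF.
Proof.
have E (p q : 'End(O)) : trace_on fullv (p \o q)%VF =
    \sum_(i < \dim {: O}) \sum_(j < \dim {: O})
    coord (vbasis fullv) j (q (vbasis fullv)`_i) *
    coord (vbasis fullv) i (p (vbasis fullv)`_j).
  apply: eq_bigr => i _; rewrite comp_lfunE.
  rewrite {1}(coord_vbasis (memvf (q (vbasis fullv)`_i))) !linear_sum.
  by apply: eq_bigr => j _; rewrite !linearZ.
rewrite !E exchange_big; apply: eq_bigr => i _; apply: eq_bigr => j _.
exact: mulrC.
Qed.

Lemma trace_on_id : trace_on fullv (\1%VF : 'End(O)) = (\dim {: O})%:R :> k.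
Proof.
rewrite /trace_on (eq_bigr (fun=> 1)) ?sumr_const ?card_ord // => i _.
rewrite id_lfunE coord_free ?eqxx //; exact: basis_free (vbasisP _).
Qed.

(** The rank-one decomposition of [f] in a basis of [U] computes the trace of
    [f] on the whole space and its trace on [U] by the same sum.  This compares
    the trace forms of the algebras of type [so(7)] and [G2]. *)
Lemma trace_on_limg U f : (limg f <= U)%VS -> trace_on fullv f = trace_on U f.
Proof.
move=> /subvP fU.
have fE x : f x = \sum_i coord (vbasis U) i (f x) *: (vbasis U)`_i.
  by apply: coord_vbasis; apply: fU; apply: memv_img; apply: memvf.
rewrite /trace_on.
under eq_bigr do rewrite fE linear_sum.
rewrite exchange_big; apply: eq_bigr => i _ /=.
rewrite [in RHS](coord_vbasis (memvf (vbasis U)`_i)) !linear_sum.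
by apply: eq_bigr => j _; rewrite !linearZ /= mulrC.
Qed.

End Trace.

(** * Bivectors in a Clifford algebra *)
Section Clifford.

Context {k : fieldType} {V : vectType k} (b : V -> V -> k).
Hypothesis char2 : 2%:R != 0 :> k.
Hypothesis bC : forall u v, b u v = b v u.
Hypothesis b_linear : forall v, scalar (b ^~ v).
Context {A : falgType k} (i : 'Hom(V, A)).
Hypothesis i_sqr : forall v, i v * i v = (- b v v)%:A.

Let bDl := sformDl b_linear.
Let bDr := sformDr bC b_linear.

Lemma clifford_swap u v : i v * i u = - (i u * i v) - (2%:R * b u v)%:A.
Proof.
have := i_sqr (u + v); rewrite linearD mulrDl !mulrDr !i_sqr bDl !bDr (bC v u).
set s := (- b u u)%:A; set t := (- b v v)%:A => E.
have -> : i v * i u = s + i u * i v + (i v * i u + t) - s - t - i u * i v.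
  by linear_ring.
by rewrite E /s /t; linear_ring.
Qed.

(** The quantisations of [u] wedge [v] and of [u] wedge [v] wedge [w], see
    [quantisation2] and [quantisation3]: these are the alternating expressions
    that reduce to plain products on orthogonal vectors. *)
Definition bivector u v : A := i u * i v + (b u v)%:A.

Definition trivector u v w : A :=
  i u * i v * i w + b u v *: i w - b u w *: i v + b v w *: i u.

Lemma clifford_swap4 a u v c :
  a * i v * i u * c = - (a * i u * i v * c) - (2%:R * b u v) *: (a * c).
Proof.
rewrite -(mulrA a) clifford_swap mulrBr mulrBl mulrN mulNr mulrA.
by rewrite -scalerAr mulr1 -scalerAl.
Qed.

(** Up to the factor [-2], anticommuting with [u] is contraction with [u]: the
    terms of degree four cancel. *)
Lemma trivector_contraction u x y z :
  i u * trivector x y z + trivector x y z * i u =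
  (- 2%:R) *: (b u x *: bivector y z - b u y *: bivector x z
               + b u z *: bivector x y).
Proof.
rewrite /trivector !mulrDl !mulrDr !mulrN !mulNr -!scalerAl -!scalerAr.
have E : i x * i y * i z * i u = - (i u * (i x * i y * i z))
    + (2%:R * b u x) *: (- (i y * i z)) + (2%:R * b u y) *: (i x * i z)
    - (2%:R * b u z) *: (i x * i y).
  have := clifford_swap4 (i x * i y) u z 1; rewrite !mulr1 => ->.
  rewrite clifford_swap4; have := clifford_swap4 1 u x (i y * i z).
  by rewrite !mul1r !mulrA => ->; linear_ring.
rewrite E (clifford_swap u x) (clifford_swap u y) (clifford_swap u z) /bivector.
by linear_ring.
Qed.

(** Scalar coefficients are absorbed into the vectors, [bivector] being
    bilinear. *)
Definition is_bivector (y : A) :=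
  exists r : seq (V * V), y = \sum_(p <- r) bivector p.1 p.2.

Lemma is_bivectorP (P : A -> Prop) :
  P 0 -> (forall x y, P x -> P y -> P (x + y)) ->
  (forall u v, P (bivector u v)) -> forall y, is_bivector y -> P y.
Proof.
move=> P0 PD Pb _ [r ->]; elim: r => [|p r IHr]; first by rewrite big_nil.
by rewrite big_cons; apply: PD.
Qed.

Context (tau : {scalar A}) (N : k).
Hypothesis tauC : forall x y, tau (x * y) = tau (y * x).
Hypothesis tau1 : tau 1 = N.

(** A central functional such as a trace is determined on even products by the
    Clifford relation: moving the first factor cyclically to the end reproduces
    the product with the opposite sign, plus shorter products. *)
Lemma tau_mul2 u v : tau (i u * i v) = - N * b u v.
Proof.
have := congr1 tau (clifford_swap u v).
rewrite tauC linearB linearN /= linearZ /= tau1 => E; apply: (mulfI char2).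
have -> : 2%:R * tau (i u * i v) = tau (i u * i v) + tau (i u * i v) by ring.
by rewrite {1}E; ring.
Qed.

Lemma tau_mul4 u v x y : tau (i u * i v * i x * i y) =
  N * (b u v * b x y - b u x * b v y + b u y * b v x).
Proof.
have E : i v * i x * i y * i u = - (i u * i v * i x * i y)
   + (2%:R * b u x) *: (i v * i y) - (2%:R * b u y) *: (i v * i x)
   - (2%:R * b u v) *: (i x * i y).
  have := clifford_swap4 (i v * i x) u y 1; rewrite !mulr1 => ->.
  rewrite clifford_swap4; have := clifford_swap4 1 u v (i x * i y).
  by rewrite !mul1r !mulrA => ->; linear_ring.
have := congr1 tau E; rewrite [tau (_ * i u)]tauC !mulrA.
rewrite !(linearB, linearN, linearD, linearZ) /= !tau_mul2 => {}E.
apply: (mulfI char2); set t := tau _ in E *.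
have -> : 2%:R * t = t + t by ring.
by rewrite {1}E; ring.
Qed.

(** The trace form on bivectors is the Gram determinant, up to scale. *)
Lemma tau_bivectors u v x y :
  tau (bivector u v * bivector x y) = - N * (b u x * b v y - b u y * b v x).
Proof.
rewrite /bivector mulrDl !mulrDr !mulrA -!scalerAr !mulr1 -!scalerAl mul1r.
rewrite !linearD /= !linearZ /= !tau_mul2 tau_mul4 tau1; ring.
Qed.

Hypothesis N_neq0 : N != 0.
Context n (e : 'I_n -> V).
Hypothesis e_frame : orthogonal_frame b e.

(** Commutation with a bivector preserves the generating space, and the trace
    form determines how: both sides are multiples of
    [b v u *: w - b w u *: v] for the bivector of [v] and [w]. *)
Lemma bivector_commutator y u : is_bivector y ->
  y * i u - i u * y =
  - (2%:R / N) *: i (\sum_j (tau (y * bivector u (e j)) / b (e j) (e j)) *: e j).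
Proof.
have [_ _ eE] := e_frame.
move: y; apply: is_bivectorP => [|x y Ex Ey|v w].
- rewrite mul0r mulr0 subr0 big1 ?linear0 ?scaler0 // => j _.
  by rewrite mul0r linear0 mul0r scale0r.
- rewrite mulrDl mulrDr.
  have -> : x * i u + y * i u - (i u * x + i u * y) =
    (x * i u - i u * x) + (y * i u - i u * y) by linear_ring.
  rewrite Ex Ey -scalerDr -linearD -big_split; congr (_ *: i _).
  apply: eq_bigr => j _.
  by rewrite mulrDl linearD /= mulrDl scalerDl.
transitivity (2%:R *: (b v u *: i w - b w u *: i v)).
  rewrite /bivector mulrDl mulrDr -!scalerAr -!scalerAl mulr1 mul1r.
  have := clifford_swap4 (i v) u w 1; rewrite !mulr1 => ->.
  rewrite (clifford_swap u v) mulrBl mulNr -scalerAl mul1r (bC v u) (bC w u).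
  by rewrite mulrA; linear_ring.
have -> : \sum_j (tau (bivector v w * bivector u (e j)) / b (e j) (e j)) *: e j
   = - N *: (b v u *: w - b w u *: v).
  rewrite [X in b v u *: X]eE [X in b w u *: X]eE !scaler_sumr -sumrB scaler_sumr.
  apply: eq_bigr => j _; rewrite tau_bivectors; linear_ring.
apply: functional_ext => f; rewrite !(linearD, linearN, linearZ) /=.
by field.
Qed.

(** A bivector is recovered from its commutators with vectors by contracting
    the two copies of an orthogonal frame. *)
Lemma bivector_reconstruct y : is_bivector y ->
  4%:R *: y = \sum_j (b (e j) (e j))^-1 *: (i (e j) * (y * i (e j) - i (e j) * y)).
Proof.
have [_ _ eE] := e_frame.
move: y; apply: is_bivectorP => [|x y Ex Ey|v w].
- rewrite scaler0 big1 // => j _.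
  by rewrite mul0r mulr0 subr0 mulr0 scaler0.
- rewrite scalerDr Ex Ey -big_split; apply: eq_bigr => j _ /=.
  rewrite -scalerDr -mulrDr; congr (_ *: _); congr (_ * _).
  by rewrite mulrDl mulrDr; linear_ring.
transitivity (2%:R *: (i v * i w - i w * i v)).
  by rewrite (clifford_swap v w) /bivector; linear_ring.
rewrite {1}[v]eE {2}[w]eE !linear_sum !mulr_suml -sumrB scaler_sumr.
apply: eq_bigr => j _; rewrite !linearZ /=.
have -> : bivector v w * i (e j) - i (e j) * bivector v w =
  2%:R *: (b v (e j) *: i w - b w (e j) *: i v).
  rewrite /bivector mulrDl mulrDr -!scalerAr -!scalerAl mulr1 mul1r.
  have := clifford_swap4 (i v) (e j) w 1; rewrite !mulr1 => ->.
  rewrite (clifford_swap (e j) v) mulrBl mulNr -scalerAl mul1r.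
  by rewrite (bC v (e j)) (bC w (e j)) mulrA; linear_ring.
rewrite -!scalerAl -scalerAr mulrBr -!scalerAr; linear_ring.
Qed.

Lemma bivector_nondeg y : is_bivector y ->
  (forall u v, tau (y * bivector u v) = 0) -> y = 0.
Proof.
move=> hy y0; have four0 : 4%:R != 0 :> k.
  by rewrite (natrM _ 2 2) mulf_neq0.
apply: (scalerI four0); rewrite scaler0 (bivector_reconstruct hy) big1 // => j _.
rewrite (bivector_commutator _ hy) big1 ?linear0 ?scaler0 ?mulr0 ?scaler0 //.
by move=> l _; rewrite y0 mul0r scale0r.
Qed.

End Clifford.

(** * Quantisation in degrees two and three *)

Lemma prodv_ind (k : fieldType) (A : falgType k) (U W : {vspace A})
    (P : A -> Prop) :
  P 0 -> (forall x y, P x -> P y -> P (x + y)) ->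
  (forall u w, u \in U -> w \in W -> P (u * w)) ->
  forall x, x \in (U * W)%VS -> P x.
Proof.
move=> P0 PD PM x; rewrite /prodv locked_withE => xUW.
rewrite (coord_span (X := in_tuple _) xUW).
apply: (big_ind P) => // j _.
have /allpairsP[[u w] /= [uU wW ->]] := mem_nth 0 (ltn_ord j).
by rewrite scalerAl; apply: PM; rewrite ?memvZ ?vbasis_mem.
Qed.

Lemma det_mx3 (k : comNzRingType) (A : 'M[k]_3) : \det A =
  A 0 0 * (A 1 1 * A 2%:R 2%:R - A 1 2%:R * A 2%:R 1)
  - A 0 1 * (A 1 0 * A 2%:R 2%:R - A 1 2%:R * A 2%:R 0)
  + A 0 2%:R * (A 1 0 * A 2%:R 1 - A 1 1 * A 2%:R 0).
Proof.
rewrite (expand_det_row _ 0) !big_ord_recl big_ord0 /cofactor.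
rewrite !(expand_det_row _ 0) !big_ord_recl !big_ord0 /cofactor !det_mx11 !mxE.
pose M (p q : nat) := A (inord p) (inord q).
have AE (p q : 'I_3) : A p q = M p q by rewrite /M !inord_val.
rewrite !AE /=; ring.
Qed.

Section ExteriorPower.

Context {k : fieldType} {V : vectType k} {L : exterior_algebra V}.
Let w := clifford_in L.

Lemma ext_power2_ind (P : L -> Prop) :
  P 0 -> (forall x y, P x -> P y -> P (x + y)) ->
  (forall u v, P (w u * w v)) ->
  forall x, x \in ext_power L 2 -> P x.
Proof.
move=> P0 PD PM; rewrite /ext_power expv2; apply: prodv_ind => // y z.
by move=> /memv_imgP[u _ ->] /memv_imgP[v _ ->].
Qed.

Lemma ext_power3_ind (P : L -> Prop) :
  P 0 -> (forall x y, P x -> P y -> P (x + y)) ->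
  (forall u v x, P (w u * w v * w x)) ->
  forall x, x \in ext_power L 3 -> P x.
Proof.
move=> P0 PD PM; rewrite /ext_power expvSl; apply: prodv_ind => // z y.
move=> /memv_imgP[u _ ->]; move: y.
apply: (ext_power2_ind (P := fun y => P (w u * y))); rewrite ?mulr0 //.
  by move=> x y Px Py; rewrite mulrDr; apply: PD.
by move=> v x; rewrite mulrA.
Qed.

Lemma wedge_sqr v : w v * w v = 0.
Proof. by rewrite clifford_sqr scale0r. Qed.

Lemma wedge_swap u v : w v * w u = - (w u * w v).
Proof.
have := wedge_sqr (u + v).
rewrite linearD mulrDl !mulrDr !wedge_sqr add0r addr0 => /eqP.
by rewrite addrC addr_eq0 => /eqP.
Qed.

Lemma wedge2 u v : w u * w v = wedge L (fun a : 'I_2 => nth 0 [:: u; v] a).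
Proof. by rewrite /wedge !big_ord_recl big_ord0 /= mulr1. Qed.

Lemma wedge3 u v x :
  w u * w v * w x = wedge L (fun a : 'I_3 => nth 0 [:: u; v; x] a).
Proof. by rewrite /wedge !big_ord_recl big_ord0 /= mulr1 mulrA. Qed.

End ExteriorPower.

Section Quantisation.

Context {k : fieldType} {V : vectType k} (b : V -> V -> k).
Hypothesis char2 : 2%:R != 0 :> k.
Hypothesis bC : forall u v, b u v = b v u.
Hypothesis b_linear : forall v, scalar (b ^~ v).
Context {A : falgType k} (i : 'Hom(V, A)).
Hypothesis i_sqr : forall v, i v * i v = (- b v v)%:A.
Context {L : exterior_algebra V} (Q : 'Hom(L, A)).
Hypothesis Q_orth : forall n (v : 'I_n -> V),
  (forall p q, p != q -> b (v p) (v q) = 0) ->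
  Q (wedge L v) = \prod_(p < n) i (v p).
Context n (e : 'I_n -> V).
Hypothesis e_frame : orthogonal_frame b e.

Let w := clifford_in L.
Let bDl := sformDl b_linear.
Let bDr := sformDr bC b_linear.
Let bZl := sformZl b_linear.
Let bZr := sformZr bC b_linear.

(** Multilinear identities need only be checked on the frame, where distinct
    vectors are orthogonal and repeated ones give zero. *)
Lemma linear_frame_ext (W : lmodType k) (f g : V -> W) :
  linear f -> linear g -> (forall j, f (e j) = g (e j)) -> f =1 g.
Proof.
have lin_sum (h : V -> W) : linear h ->
    forall x, h x = \sum_j (b x (e j) / b (e j) (e j)) *: h (e j).
  move=> lh x; have [_ _ eE] := e_frame.
  pose h' : {linear V -> W} := HB.pack h (GRing.isLinear.Build k V W *:%R h lh).
  rewrite {1}(eE x) -[h]/(h' : V -> W) linear_sum.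
  by apply: eq_bigr => j _; rewrite linearZ.
move=> /lin_sum fE /lin_sum gE E x; rewrite fE gE.
by apply: eq_bigr => j _; rewrite E.
Qed.

Lemma quantisation2 u v : Q (w u * w v) = bivector b i u v.
Proof.
have [e_orth _ _] := e_frame.
have ee p q : Q (w (e p) * w (e q)) = bivector b i (e p) (e q).
  have [->|pq] := eqVneq p q.
    by rewrite wedge_sqr linear0 /bivector i_sqr; linear_ring.
  rewrite wedge2 Q_orth; last first.
    by case=> [[|[|//]] ?] [[|[|//]] ?] //= _; rewrite ?(bC (e q)) e_orth.
  rewrite !big_ord_recl big_ord0 /= mulr1 /bivector e_orth // scale0r.
  by rewrite addr0.
have ev p v' : Q (w (e p) * w v') = bivector b i (e p) v'.
  move: v'; apply: linear_frame_ext => // a x y.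
    by rewrite linearP mulrDr -scalerAr linearP.
  by rewrite /bivector bDr bZr linearP mulrDr -scalerAr; linear_ring.
move: u; apply: linear_frame_ext => // a x y.
  by rewrite linearP mulrDl -scalerAl linearP.
by rewrite /bivector bDl bZl linearP mulrDl -scalerAl; linear_ring.
Qed.

Lemma trivector_alt12 u v : trivector b i u u v = 0.
Proof. by rewrite /trivector i_sqr -scalerAl mul1r; linear_ring. Qed.

Lemma trivector_alt23 u v : trivector b i u v v = 0.
Proof.
by rewrite /trivector -mulrA i_sqr -scalerAr mulr1; linear_ring.
Qed.

Lemma trivector_alt13 u v : trivector b i u v u = 0.
Proof.
rewrite /trivector (clifford_swap bC b_linear i_sqr v u) mulrBl mulNr -mulrA.
by rewrite i_sqr -scalerAr mulr1 -scalerAl mul1r (bC v u); linear_ring.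
Qed.

Lemma quantisation3 u v x : Q (w u * w v * w x) = trivector b i u v x.
Proof.
have [e_orth _ _] := e_frame.
have eee p q r : Q (w (e p) * w (e q) * w (e r)) =
    trivector b i (e p) (e q) (e r).
  have [->|pq] := eqVneq p q.
    by rewrite wedge_sqr mul0r linear0 trivector_alt12.
  have [->|qr] := eqVneq q r.
    by rewrite -mulrA wedge_sqr mulr0 linear0 trivector_alt23.
  have [->|pr] := eqVneq p r.
    rewrite (wedge_swap (e q)) mulNr -mulrA wedge_sqr mulr0 oppr0 linear0.
    by rewrite trivector_alt13.
  rewrite wedge3 Q_orth; last first.
    case=> [[|[|[|//]]] ?] [[|[|[|//]]] ?] //= _;
      by apply: e_orth; rewrite // eq_sym.
  rewrite !big_ord_recl big_ord0 /= mulr1 /trivector !e_orth // !scale0r.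
  by rewrite subr0 !addr0 mulrA.
have eev p q x' : Q (w (e p) * w (e q) * w x') = trivector b i (e p) (e q) x'.
  move: x'; apply: linear_frame_ext => // a y z.
    by rewrite linearP mulrDr -scalerAr linearP.
  by rewrite /trivector !bDr !bZr linearP mulrDr -scalerAr; linear_ring.
have evv p v' x' : Q (w (e p) * w v' * w x') = trivector b i (e p) v' x'.
  move: v'; apply: linear_frame_ext => // a y z.
    by rewrite linearP mulrDr mulrDl -scalerAr -scalerAl linearP.
  rewrite /trivector bDr bDl bZr bZl linearP mulrDr mulrDl -scalerAr -scalerAl.
  by linear_ring.
move: u; apply: linear_frame_ext => // a y z.
  by rewrite linearP !mulrDl -!scalerAl linearP.
rewrite /trivector !bDl !bZl linearP !mulrDl -!scalerAl.
by linear_ring.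
Qed.

Lemma quantisation_power2P y :
  reflect (is_bivector b i y) (y \in (Q @: ext_power L 2)%VS).
Proof.
apply: (iffP memv_imgP) => [[x xL ->]|].
  move: x xL; apply: ext_power2_ind => [|x z|u v].
  - by exists [::]; rewrite big_nil linear0.
  - by move=> [r rE] [s sE]; exists (r ++ s); rewrite big_cat /= -rE -sE linearD.
  - by exists [:: (u, v)]; rewrite big_seq1 quantisation2.
move: y; apply: is_bivectorP => [|x y' [x' x'L ->] [y'' y''L ->]|u v].
- by exists 0; rewrite ?mem0v ?linear0.
- by exists (x' + y''); rewrite ?rpredD ?linearD.
- exists (w u * w v); rewrite ?quantisation2 //.
  by rewrite /ext_power expv2 memv_mul // memv_img // memvf.
Qed.

Context (tau : {scalar A}) (N : k).
Hypothesis tauC : forall x y, tau (x * y) = tau (y * x).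
Hypothesis tau1 : tau 1 = N.
Context (eta : 'Hom(L, 'Hom(L, k^o))).
Hypothesis eta_det : forall n (v v' : 'I_n -> V),
  eta (wedge L v) (wedge L v') = \det (\matrix_(p < n, q < n) b (v p) (v' q)).

(** The trace form on bivectors being [eta] up to scale, pairing with the
    contraction of [a] by [u] is evaluating [eta a] with [u] in first place. *)
Lemma quantisation3_contraction u a : a \in ext_power L 3 ->
  is_bivector b i (i u * Q a + Q a * i u) /\
  forall x y, tau ((i u * Q a + Q a * i u) * bivector b i x y) =
    2%:R * N * eta a (w u * w x * w y).
Proof.
move: a; apply: ext_power3_ind => [|a c [a1 a2] [c1 c2]|x1 x2 x3].
- rewrite !linear0 mulr0 mul0r addr0; split=> [|x y].
    by exists [::]; rewrite big_nil.
  by rewrite mul0r linear0 zero_lfunE mulr0.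
- have -> : i u * Q (a + c) + Q (a + c) * i u =
     (i u * Q a + Q a * i u) + (i u * Q c + Q c * i u).
    by rewrite linearD mulrDr mulrDl; linear_ring.
  split=> [|x y]; last first.
    by rewrite mulrDl linearD /= a2 c2 linearD add_lfunE /= mulrDr.
  case: a1 c1 => [r ->] [s ->]; exists (r ++ s); by rewrite big_cat.
rewrite quantisation3 (trivector_contraction bC b_linear i_sqr); split.
  exists [:: ((- 2%:R * b u x1) *: x2, x3); ((2%:R * b u x2) *: x1, x3);
             ((- 2%:R * b u x3) *: x1, x2)].
  rewrite !big_cons big_nil /bivector /= !bZl !linearZ /= -!scalerAl.
  by linear_ring.
move=> x y; rewrite -scalerAl mulrDl mulrBl -!scalerAl.
rewrite linearZ linearD linearB !linearZ /=.
rewrite !(tau_bivectors char2 bC b_linear i_sqr tauC tau1).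
by rewrite !wedge3 eta_det det_mx3 !mxE /= !(bC _ u); ring.
Qed.

End Quantisation.

(** * Octonions and the cross product *)
Section Octonions.

Context {k : fieldType} {O : octonionType k}.
Hypothesis char2 : 2%:R != 0 :> k.
Implicit Types (x y z : O) (u v w : ImO O).

Lemma bformC x y : bform x y = bform y x.
Proof. by rewrite /bform opolarC. Qed.

Lemma bform_linear y : scalar (bform^~ y).
Proof. by move=> a x z; rewrite /bform opolarPl; ring. Qed.

Let bDl := sformDl (@bform_linear).
Let bDr := sformDr bformC (@bform_linear).
Let bZl := sformZl (@bform_linear).
Let bZr := sformZr bformC (@bform_linear).

Lemma bform_norm x : bform x x = onorm x.
Proof.
have xx : x + x = 2%:R *: x by rewrite scaler_nat.
by rewrite /bform /opolar xx onormZ; field.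
Qed.

Lemma bform_nondeg x : (forall y, bform x y = 0) -> x = 0.
Proof.
move=> x0; apply: onorm_nondeg => y; have := x0 y; rewrite /bform -/(opolar x y).
by move/eqP; rewrite mulf_eq0 invr_eq0 (negPf char2) => /eqP.
Qed.

Lemma omulZl (a : k) x y : omul (a *: x) y = a *: omul x y.
Proof.
have m0 : omul 0 y = 0 by apply: (addrI (omul 0 y)); rewrite -omulDl !addr0.
by rewrite -[a *: x]addr0 omulPl m0 addr0.
Qed.

Lemma omulZr (a : k) x y : omul x (a *: y) = a *: omul x y.
Proof.
have m0 : omul x 0 = 0 by apply: (addrI (omul x 0)); rewrite -omulDr !addr0.
by rewrite -[a *: y]addr0 omul_linearr m0 addr0.
Qed.

Lemma oone_neq0 : oone != 0 :> O.
Proof.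
apply: contraTneq (_ : (0 < \dim {: O})%N) => [E|]; last by rewrite odim.
rewrite -leqNgt leqn0 dimv_eq0; apply/eqP/vspaceP => x.
have m0 : omul 0 x = 0 by have := omulZl 0 0 x; rewrite !scale0r.
by rewrite memvf memv0 -(omul1o x) E m0 eqxx.
Qed.

(** The norm of [1] is idempotent; if it vanished, multiplicativity would make
    the norm zero. *)
Lemma bform11 : bform (oone : O) oone = 1.
Proof.
rewrite bform_norm; apply/eqP; have := onormM (oone : O) oone.
rewrite omulo1 => /eqP; rewrite -subr_eq0 -{1}[onorm _]mulr1 -mulrBr mulf_eq0.
rewrite subr_eq0 [1 == _]eq_sym => /orP[/eqP n0|//]; case/eqP: oone_neq0.
have nz x : onorm x = 0 by rewrite -(omulo1 x) onormM n0 mulr0.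
by apply: bform_nondeg => y; rewrite /bform /opolar !nz !subr0 mulr0.
Qed.

Lemma mem_oIm_bform x : (x \in oIm) = (bform x oone == 0).
Proof.
rewrite mem_oIm /oconj -subr_eq0 opprK subrK scaler_eq0 (negPf oone_neq0) orbF.
by rewrite /bform mulf_eq0 invr_eq0 (negPf char2).
Qed.

Lemma dim_oIm : \dim (oIm : {vspace O}) = 7%N.
Proof.
have := limg_ker_dim (linfun (oconjD : O -> O)) fullv; rewrite capfv odim -/oIm.
have -> : (linfun (oconjD : O -> O) @: fullv)%VS = <[oone : O]>%VS.
  apply/eqP; rewrite eqEsubv; apply/andP; split.
    apply/subvP => _ /memv_imgP[x _ ->].
    by rewrite lfunE /= /oconjD /oconj subrK memvZ // memv_line.
  rewrite -memvE; have -> : oone = linfun (oconjD : O -> O) (2%:R^-1 *: oone).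
    have := bform11; rewrite /bform => b11.
    by rewrite lfunE linearZ /= /oconjD /oconj subrK scalerA b11 scale1r.
  by rewrite memv_img // memvf.
by rewrite dim_vline oone_neq0 addn1 => -[].
Qed.

Definition im_form u v : k := bform (vsval u) (vsval v).

Lemma im_formC u v : im_form u v = im_form v u.
Proof. exact: bformC. Qed.

Lemma im_form_linear v : scalar (im_form ^~ v).
Proof. by move=> a u w; rewrite /im_form linearP bform_linear. Qed.

Lemma im_one u : bform (vsval u) oone = 0.
Proof. by apply/eqP; rewrite -mem_oIm_bform subvsP. Qed.

Lemma im_form_nondeg u : (forall v, im_form u v = 0) -> u = 0.
Proof.
move=> u0; apply: val_inj; apply: bform_nondeg => x.
have xI : x - bform x oone *: oone \in oIm.
  rewrite mem_oIm_bform -scaleNr bDl bZl bform11; apply/eqP; ring.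
have := u0 (Subvs xI); rewrite /im_form /= -scaleNr bDr bZr im_one.
by rewrite mulr0 addr0.
Qed.

Lemma im_mul_skew u x y :
  bform (omul (vsval u) x) y = - bform x (omul (vsval u) y).
Proof.
have E := opolar_mulDl (vsval u) x y; have := im_one u.
rewrite /bform => /eqP; rewrite mulf_eq0 invr_eq0 (negPf char2) /= => /eqP u1.
apply/eqP; rewrite -addr_eq0 -mulrDr E u1 mul0r mulr0 //.
Qed.

Lemma im_mul_sqr u x :
  omul (vsval u) (omul (vsval u) x) = - onorm (vsval u) *: x.
Proof.
apply/eqP; rewrite -subr_eq0; apply/eqP; apply: bform_nondeg => y.
rewrite -scaleNr opprK bDl bZl im_mul_skew /bform opolarM; ring.
Qed.

(** The symmetric part of the product of imaginary octonions is minus the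
    form, so the cross product, its antisymmetric part, is what is left. *)
Lemma crossE u v :
  vsval (crossIm u v) = omul (vsval u) (vsval v) + im_form u v *: oone.
Proof.
have conj w : oconj (vsval w) = - vsval w by apply/eqP; rewrite -mem_oIm subvsP.
have sq w : omul (vsval w) (vsval w) = - im_form w w *: oone.
  by rewrite -[X in omul _ X]omulo1 im_mul_sqr /im_form bform_norm.
have := sq (u + v); rewrite linearD /= omulDl !omulDr !sq.
rewrite !(sformDl im_form_linear) !(sformDr im_formC im_form_linear).
rewrite (im_formC v u); set a := omul (vsval u) _; set c := omul (vsval v) _ => E.
rewrite /= /cross !conj -!scaleN1r !omulZl -/a -/c.
have -> : c = (- im_form u u *: oone + a + (c + - im_form v v *: oone)) - a
   + (im_form u u + im_form v v) *: oone by linear_ring.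
rewrite E; apply: functional_ext => f.
rewrite !(linearD, linearN, linearZ) /=; field.
exact: char2.
Qed.

Lemma phiE u v w : phi u v w = bform (vsval u) (omul (vsval v) (vsval w)).
Proof. by rewrite /phi crossE bDr bZr im_one mulr0 addr0. Qed.

Lemma phi_cross u v w : phi u v w = im_form u (crossIm v w).
Proof. by []. Qed.

Lemma crossC u v : crossIm u v = - crossIm v u.
Proof.
apply: val_inj; rewrite /= /cross.
have conj w : oconj (vsval w) = - vsval w by apply/eqP; rewrite -mem_oIm subvsP.
by rewrite !conj -!scaleN1r !omulZl; linear_ring.
Qed.

Lemma phi_swap23 u v w : phi u w v = - phi u v w.
Proof.
by rewrite !phi_cross crossC (sformNr im_formC im_form_linear).
Qed.

Lemma phi_swap13 u v w : phi w v u = - phi u v w.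
Proof. by rewrite !phiE bformC im_mul_skew. Qed.

Lemma phi_swap12 u v w : phi v u w = - phi u v w.
Proof. by rewrite phi_swap13 phi_swap23 opprK phi_swap13. Qed.

Lemma phi_rot u v w : phi u v w = phi w u v.
Proof. by rewrite phi_swap12 phi_swap13 opprK phi_swap12 phi_swap23 opprK. Qed.

Lemma phi_alt u v : phi u u v = 0.
Proof.
apply: (mulfI char2); rewrite mulr0.
have -> : 2%:R * phi u u v = phi u u v + phi u u v by ring.
by rewrite {2}phi_swap12 subrr.
Qed.

Lemma cross_cross u v :
  crossIm u (crossIm u v) = im_form u v *: u - im_form u u *: v.
Proof.
apply: (subvs_inj (U := oIm)); rewrite crossE.
have -> : im_form u (crossIm u v) = phi u u v by [].
rewrite phi_alt scale0r addr0 crossE omulDr omulZr omulo1 im_mul_sqr.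
by rewrite -bform_norm // -/(im_form u u) linearB !linearZ /=; linear_ring.
Qed.

End Octonions.

(** * The bivectors c_u and the moment maps *)
Section Spinor.

Context {k : fieldType} {O : octonionType k}.
Hypothesis char2 : 2%:R != 0 :> k.
Context {A : falgType k} (i : 'Hom(ImO O, A)).
Hypothesis i_norm : forall v, i v * i v = (- onorm (vsval v))%:A.
Context (rho : 'Hom(A, 'End(O))).
Hypothesis rho1 : rho 1 = \1%VF.
Hypothesis rhoM : forall x y, rho (x * y) = (rho x \o rho y)%VF.
Hypothesis rhoI : forall (u : ImO O) x, rho (i u) x = omul (vsval u) x.
Implicit Types (u v w : ImO O).

Let b : ImO O -> ImO O -> k := im_form.
Let bC : forall u v, b u v = b v u := im_formC.
Let b_linear : forall v, scalar (b ^~ v) := im_form_linear.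
Let BC : forall x y : O, bform x y = bform y x := bformC.
Let BDl := sformDl (@bform_linear _ O).
Let BDr := sformDr BC (@bform_linear _ O).
Let BZl := sformZl (@bform_linear _ O).
Let BZr := sformZr BC (@bform_linear _ O).

Lemma clifford_in_sqr v : i v * i v = (- b v v)%:A.
Proof. by rewrite i_norm /b /im_form bform_norm. Qed.

Definition spinor_trace (x : A) : k := trace_on fullv (rho x).

Fact spinor_trace_scalar : scalar spinor_trace.
Proof. by move=> a x y; rewrite /spinor_trace linearP trace_on_is_scalar. Qed.

HB.instance Definition _ :=
  GRing.isLinear.Build k A k *%R spinor_trace spinor_trace_scalar.

Let tau : {scalar A} := spinor_trace.

Lemma spinor_traceC x y : tau (x * y) = tau (y * x).
Proof.
by rewrite /tau /= /spinor_trace !rhoM trace_on_mulC.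
Qed.

Lemma spinor_trace1 : tau 1 = 8%:R.
Proof.
by rewrite /tau /= /spinor_trace rho1 trace_on_id odim.
Qed.

Lemma rho_bivector u v x : rho (bivector b i u v) x =
  omul (vsval u) (omul (vsval v) x) + b u v *: x.
Proof.
rewrite /bivector linearD linearZ /= rho1 rhoM add_lfunE comp_lfunE !rhoI.
by rewrite scale_lfunE id_lfunE.
Qed.

(** The action on the unit octonion is the cross product, which links the
    annihilator of [1] to the form [phi]. *)
Lemma rho_bivector1 u v : rho (bivector b i u v) oone = vsval (crossIm u v).
Proof. by rewrite rho_bivector crossE // omulo1. Qed.

Lemma rho_skew y : is_bivector b i y ->
  forall x z, bform (rho y x) z = - bform x (rho y z).
Proof.
move: y; apply: is_bivectorP => [x z|y1 y2 s1 s2 x z|u v x z].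
- have B0 t : bform (0 : O) t = 0 := sform0l (@bform_linear _ O) t.
  by rewrite linear0 !zero_lfunE (BC x) !B0 oppr0.
- by rewrite linearD !add_lfunE BDl BDr s1 s2; ring.
have E : omul (vsval v) (omul (vsval u) z) =
  - omul (vsval u) (omul (vsval v) z) - (2%:R * b u v) *: z.
  have := congr1 rho (clifford_swap bC b_linear clifford_in_sqr u v).
  rewrite linearB linearN linearZ /= rho1 !rhoM => /lfunP /(_ z).
  by rewrite !(add_lfunE, opp_lfunE, scale_lfunE, id_lfunE, comp_lfunE) !rhoI.
rewrite !rho_bivector BDl BDr BZl BZr !im_mul_skew // opprK E.
by rewrite -scaleN1r -scaleNr BDr !BZr; ring.
Qed.

Context {L : exterior_algebra (ImO O)} (Q : 'Hom(L, A)).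
Hypothesis Q_orth : forall n (v : 'I_n -> ImO O),
  (forall p q, p != q -> b (v p) (v q) = 0) ->
  Q (wedge L v) = \prod_(p < n) i (v p).
Context (eta : 'Hom(L, 'Hom(L, k^o))).
Hypothesis eta_det : is_eta eta.
Context (omega : L).
Hypothesis omega_phi : is_eta_inv_phi eta omega.

Definition c_bivector u : A := i u * Q omega + Q omega * i u.
Let c := c_bivector.

Lemma im_frame_exists :
  exists e : 'I_7 -> ImO O, orthogonal_frame b e.
Proof.
have := orthogonal_frame_exists char2 bC b_linear (im_form_nondeg char2).
have d7 : \dim {: ImO O} = 7%N by rewrite dimvf; exact: dim_oIm.
by rewrite d7.
Qed.

Lemma quantised_bivectorP y :
  reflect (is_bivector b i y) (y \in (Q @: ext_power L 2)%VS).
Proof.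
apply: (iffP idP); have [e e_frame] := im_frame_exists;
  have P := quantisation_power2P bC b_linear clifford_in_sqr Q_orth e_frame y;
  by move/P.
Qed.

(** This characterises [c u] inside the bivectors: under the trace form it is
    dual to contraction of [phi] with [u]. *)
Lemma c_bivector_spec u : is_bivector b i (c u) /\
  forall x y, tau (c u * bivector b i x y) = 16%:R * phi u x y.
Proof.
have [e e_frame] := im_frame_exists.
have [omega3 omegaE] := omega_phi.
have [c2 ctau] := quantisation3_contraction char2 bC b_linear clifford_in_sqr
  Q_orth e_frame spinor_traceC spinor_trace1 eta_det u omega3.
split=> // x y; rewrite [LHS]ctau wedge3 omegaE /=; ring.
Qed.

(** By this lemma, bivectors that kill [1] are orthogonal to every [c u]. *)
Lemma c_bivector_pairing u y : is_bivector b i y ->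
  tau (c u * y) = 16%:R * bform (vsval u) (rho y oone).
Proof.
have [_ ctau] := c_bivector_spec u.
move: y; apply: is_bivectorP => [|x y Ex Ey|v w].
- by rewrite mulr0 !linear0 zero_lfunE BC (sform0l (@bform_linear _ O)) mulr0.
- by rewrite mulrDr !linearD /= Ex Ey add_lfunE BDr mulrDr.
- by rewrite ctau rho_bivector1.
Qed.

Let eight_neq0 : 8%:R != 0 :> k.
Proof. by rewrite (natrM _ 2 4) (natrM _ 2 2) !mulf_neq0. Qed.

Lemma c_bivector_commutator u v :
  c u * i v - i v * c u = (- 4%:R) *: i (crossIm u v).
Proof.
have [e e_frame] := im_frame_exists; have [c2 ctau] := c_bivector_spec u.
rewrite (bivector_commutator char2 bC b_linear clifford_in_sqr spinor_traceC
  spinor_trace1 eight_neq0 e_frame) //.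
have [_ e2 eE] := e_frame.
rewrite [in RHS](eE (crossIm u v)) -linearZ -[RHS]linearZ; congr (i _).
rewrite !scaler_sumr; apply: eq_bigr => j _.
rewrite ctau (_ : b (crossIm u v) (e j) = phi u v (e j)); last first.
  by rewrite phi_rot // phi_cross bC.
by rewrite !scalerA; congr (_ *: _); field; rewrite e2 eight_neq0.
Qed.

(** Reconstructing [c u] from its commutators with a frame [e] of seven vectors
    and applying it to [1] leaves the sum of the double cross products
    [e j x (e j x u)], each divided by [b (e j) (e j)].  By [cross_cross] the
    terms are [(b u (e j) / b (e j) (e j)) *: e j - u], with sum [u - 7 u]. *)
Lemma rho_c_bivector1 u : rho (c u) oone = - 6%:R *: vsval u.
Proof.
have [e e_frame] := im_frame_exists; have [c2 ctau] := c_bivector_spec u.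
have four0 : 4%:R != 0 :> k by rewrite (natrM _ 2 2) mulf_neq0.
apply: (scalerI four0).
rewrite -scale_lfunE -linearZ /=.
rewrite (bivector_reconstruct bC b_linear clifford_in_sqr e_frame c2).
have [_ e2 eE] := e_frame.
rewrite linear_sum sum_lfunE.
transitivity (\sum_j (4%:R *: ((b u (e j) / b (e j) (e j)) *: vsval (e j)
   - vsval u))).
  apply: eq_bigr => j _; rewrite c_bivector_commutator linearZ /= scale_lfunE.
  rewrite -scalerAr linearZ /= scale_lfunE rhoM comp_lfunE !rhoI omulo1.
  have -> : omul (vsval (e j)) (vsval (crossIm u (e j))) =
      - vsval (crossIm (e j) (crossIm (e j) u)).
    have -> : vsval (crossIm (e j) (crossIm (e j) u)) =
        omul (vsval (e j)) (vsval (crossIm (e j) u)).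
      by rewrite crossE // -phi_cross phi_alt // scale0r addr0.
    by rewrite crossC // linearN -scaleN1r omulZr scaleN1r.
  rewrite cross_cross // linearB !linearZ /= -/(b (e j) u) -/(b (e j) (e j)).
  rewrite (bC (e j) u) scalerA; apply: functional_ext => f.
  by rewrite !(linearD, linearN, linearZ) /=; field; apply: e2.
rewrite -scaler_sumr sumrB sumr_const card_ord -scaler_nat; congr (_ *: _).
have -> : \sum_j (b u (e j) / b (e j) (e j)) *: vsval (e j) = vsval u.
  by rewrite [in RHS](eE u) linear_sum; apply: eq_bigr => j _; rewrite linearZ.
by linear_ring.
Qed.

(** Applying the commutator identity to [1] moves the action of [c u] from [v]
    to [1]. *)
Lemma rho_c_bivector u v :
  rho (c u) (vsval v) = 2%:R *: vsval (crossIm u v) + (6%:R * b u v) *: oone.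
Proof.
have E : rho (c u) (vsval v) - (- 6%:R *: omul (vsval v) (vsval u)) =
    - 4%:R *: vsval (crossIm u v).
  have := congr1 rho (c_bivector_commutator u v).
  rewrite linearB linearZ /= !rhoM => /lfunP /(_ oone).
  rewrite !(add_lfunE, opp_lfunE, scale_lfunE, comp_lfunE) !rhoI.
  by rewrite rho_c_bivector1 omulZr !omulo1.
have vu : omul (vsval v) (vsval u) = - vsval (crossIm u v) - b u v *: oone.
  have -> : vsval (crossIm u v) = - vsval (crossIm v u).
    by rewrite crossC // linearN.
  by rewrite crossE // -/(b v u) (bC v u); linear_ring.
have -> : rho (c u) (vsval v) =
  rho (c u) (vsval v) - (- 6%:R *: omul (vsval v) (vsval u))
  + (- 6%:R) *: omul (vsval v) (vsval u) by linear_ring.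
by rewrite E vu; linear_ring.
Qed.

Hypothesis char3 : 3%:R != 0 :> k.

Let six_neq0 : 6%:R != 0 :> k.
Proof. by rewrite (natrM _ 3 2) mulf_neq0. Qed.

Lemma c_bivectorP u : is_bivector b i (c u).
Proof. by have [] := c_bivector_spec u. Qed.

Lemma bivector_eq m m' : is_bivector b i m -> is_bivector b i m' ->
  (forall x y, tau (bivector b i x y * m) = tau (bivector b i x y * m')) ->
  m = m'.
Proof.
move=> /quantised_bivectorP hm /quantised_bivectorP hm' E.
apply/eqP; rewrite -subr_eq0; apply/eqP.
have [e e_frame] := im_frame_exists.
apply: (bivector_nondeg char2 bC b_linear clifford_in_sqr spinor_traceC
  spinor_trace1 eight_neq0 e_frame) => [|x y].
  exact/quantised_bivectorP/rpredB.
by rewrite spinor_traceC mulrBr linearB /= E subrr.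
Qed.

Let tauE x y : trace_on fullv (rho x \o rho y)%VF = tau (x * y).
Proof. by rewrite /tau /= /spinor_trace rhoM. Qed.

Lemma spinor_moment_one u m : is_bivector b i m ->
  (forall x, is_bivector b i x -> - (3%:R / 8%:R) *
     trace_on fullv (rho x \o rho m)%VF = bform (rho x (vsval u)) oone) ->
  m = (1 / 6%:R) *: c u.
Proof.
move=> hm mE; apply: bivector_eq => // [|x y].
  by apply/quantised_bivectorP/memvZ/quantised_bivectorP/c_bivectorP.
have hxy : is_bivector b i (bivector b i x y).
  by exists [:: (x, y)]; rewrite big_seq1.
have := mE _ hxy; rewrite tauE rho_skew // rho_bivector1 => E.
rewrite -scalerAr linearZ /= (spinor_traceC _ (c u)).
rewrite c_bivector_pairing // rho_bivector1.
have -> : tau (bivector b i x y * m) =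
    - (8%:R / 3%:R) * (- (3%:R / 8%:R) * tau (bivector b i x y * m)).
  by field; rewrite char3 eight_neq0.
by rewrite E; field; rewrite six_neq0 char3.
Qed.

(** A bivector [g] splits as [d - 1/6 *: c p], where [p] is the value of [g]
    at [1] and [d] kills [1].  On [d] the trace over the octonions is the trace
    over their imaginary part, which gives the first summand; the second
    accounts for [c p], which is orthogonal to all bivectors that kill [1]. *)
Lemma spinor_moment_im u v m m' :
  is_bivector b i m -> is_bivector b i m' -> rho m' oone = 0 ->
  (forall x, is_bivector b i x -> rho x oone = 0 -> - (1 / 3%:R) *
     trace_on oIm (rho x \o rho m')%VF = bform (rho x (vsval u)) (vsval v)) ->
  (forall x, is_bivector b i x -> - (3%:R / 8%:R) *
     trace_on fullv (rho x \o rho m)%VF = bform (rho x (vsval u)) (vsval v)) ->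
  m = (8%:R / 9%:R) *: m' + (1 / 18%:R) *: c (crossIm u v).
Proof.
move=> hm hm' m'1 m'E mE; apply: bivector_eq => // [|x y].
  apply/quantised_bivectorP/rpredD; apply/memvZ/quantised_bivectorP => //.
  exact: c_bivectorP.
have hg : is_bivector b i (bivector b i x y).
  by exists [:: (x, y)]; rewrite big_seq1.
move: (bivector b i x y) hg (rho_bivector1 x y) => g hg.
move: (crossIm x y) => p g1.
(* The coefficient 1/6 cancels the eigenvalue -6 of [rho_c_bivector1]. *)
pose d := g + (1 / 6%:R) *: c p.
have hd : is_bivector b i d.
  apply/quantised_bivectorP/rpredD; first exact/quantised_bivectorP.
  by apply/memvZ/quantised_bivectorP/c_bivectorP.
have d1 : rho d oone = 0.
  rewrite linearD linearZ /= add_lfunE scale_lfunE g1 rho_c_bivector1.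
  by rewrite scalerA mul1r mulrN mulVf // scaleN1r subrr.
have d_m' : tau (d * m') = - 3%:R * bform (rho d (vsval u)) (vsval v).
  rewrite -(m'E _ hd d1) -tauE (trace_on_limg (U := oIm)).
    by field.
  (* Skewness: the image of [d] is orthogonal to [1], which [d] kills. *)
  apply/subvP => _ /memv_imgP[z _ ->]; rewrite comp_lfunE mem_oIm_bform //.
  by rewrite rho_skew // d1 BC (sform0l (@bform_linear _ O)) oppr0.
have d_c : tau (d * c (crossIm u v)) = 0.
  rewrite spinor_traceC c_bivector_pairing // d1 BC (sform0l (@bform_linear _ O)).
  by rewrite mulr0.
have c_m' : tau (c p * m') = 0.
  by rewrite c_bivector_pairing // m'1 BC (sform0l (@bform_linear _ O)) mulr0.
have c_c : tau (c p * c (crossIm u v)) = - 96%:R * b p (crossIm u v).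
  rewrite c_bivector_pairing //; last exact: c_bivectorP.
  by rewrite rho_c_bivector1 BZr /b /im_form; ring.
have c_uv : bform (rho (c p) (vsval u)) (vsval v) = 2%:R * b p (crossIm u v).
  rewrite rho_c_bivector BDl (BZl 2%:R) (BZl (6%:R * _)) (BC oone).
  rewrite im_one // mulr0 addr0; congr (_ * _).
  rewrite BC -[bform _ _]/(phi v p u) -[RHS]/(phi p u v).
  by rewrite [RHS]phi_rot.
have gE : g = d - (1 / 6%:R) *: c p by rewrite addrK.
have g_m : tau (g * m) = - (8%:R / 3%:R) * bform (rho g (vsval u)) (vsval v).
  by rewrite -(mE _ hg) tauE; field; rewrite char3 eight_neq0.
rewrite g_m mulrDr -!scalerAr linearD !linearZ /=.
have -> : tau (g * m') = tau (d * m') - 1 / 6%:R * tau (c p * m').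
  by rewrite gE mulrBl linearB -scalerAl linearZ.
have -> : tau (g * c (crossIm u v)) = tau (d * c (crossIm u v))
    - 1 / 6%:R * tau (c p * c (crossIm u v)).
  by rewrite gE mulrBl linearB -scalerAl linearZ.
rewrite d_m' d_c c_m' c_c gE linearB linearZ /=.
rewrite add_lfunE opp_lfunE scale_lfunE -scaleNr BDl BZl c_uv.
have nine_neq0 : 9%:R != 0 :> k by rewrite (natrM _ 3 3) mulf_neq0.
by field; rewrite six_neq0 nine_neq0 char3 (natrM _ 9 2) mulf_neq0.
Qed.

End Spinor.

Theorem proposition5p3 (k : fieldType)
  (char_neq2 : 2%N \notin [pchar k]) (char_neq3 : 3%N \notin [pchar k])
  (O : octonionType k)
  (L : exterior_algebra (ImO O)) (C : ClO O)
  (rho : 'Hom(C, 'End(O))) (rho_spinor : is_spinor rho)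
  (Q : 'Hom(L, C)) (Q_quant : is_quantisation Q)
  (eta : 'Hom(L, 'Hom(L, k^o))) (eta_det : is_eta eta)
  (omega : L) (omega_phi : is_eta_inv_phi eta omega)
  (mu_Im : ImO O -> ImO O -> C)
  (mu_Im_moment : is_moment_map rho (g_alg Q rho) (B_g rho) vsval mu_Im)
  (mu_O : O -> O -> C)
  (mu_O_moment : is_moment_map rho (h_alg Q) (B_h rho) id mu_O) :
  (forall u v : ImO O,
     mu_O (vsval u) (vsval v) =
       (8%:R / 9%:R) *: mu_Im u v + (1 / 18%:R) *: c_elt Q omega (crossIm u v))
  /\
  (forall u : ImO O,
     mu_O (vsval u) oone = (1 / 6%:R) *: c_elt Q omega u).
Proof.
have char2 : 2%:R != 0 :> k by [].
have char3 : 3%:R != 0 :> k by [].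
have [rho1 rhoM rhoI] := rho_spinor.
have [_ Q_orth] := Q_quant.
have hP := quantised_bivectorP char2 (clifford_sqr C) Q_orth.
have [_ _ _ muO_h muO_B] := mu_O_moment.
have [_ _ _ muI_g muI_B] := mu_Im_moment.
split=> [u v|u].
  have /andP[muI_h /eqP muI1] := muI_g u v.
  apply: (spinor_moment_im char2 (clifford_sqr C) rho1 rhoM rhoI Q_orth
    eta_det omega_phi char3) => //.
  - exact/hP/muO_h.
  - exact/hP.
  - move=> x /hP xh x1; apply: muI_B; apply/andP; split=> //; exact/eqP.
  - by move=> x /hP xh; apply: muO_B.
apply: (spinor_moment_one char2 (clifford_sqr C) rho1 rhoM rhoI Q_orth
    eta_det omega_phi char3) => //.
- exact/hP/muO_h.
- by move=> x /hP xh; apply: muO_B.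
Qed.
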